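(* Let $G$ be an AG-group, let $\mu\in NF(G)$ be a normal fuzzy AG-subgroup of $G$, and let $G/\mu=\{\mu_x : x\in G\}$ be the set of fuzzy cosets of $\mu$. Then $G/\mu$ forms an AG-group under the operation $\circ$ defined by $\mu_x\circ\mu_y=\mu_{xy}$ for all $x,y\in G$.
   Context: An AG-group is a set $G$ with a binary operation (written as juxtaposition; $xy\cdot z$ means $(xy)z$) satisfying the left invertive law $(ab)c=(cb)a$ for all $a,b,c\in G$, such that there is a unique left identity $e\in G$ ($ea=a$ for all $a\in G$) and for every $a\in G$ there is $a^{-1}\in G$ with $a^{-1}a=aa^{-1}=e$. The operation need not be associative or commutative. A fuzzy subset of $G$ is a map $\mu:G\to[0,1]$. Write $s\wedge t=\min(s,t)$. A fuzzy subset $\mu$ is a fuzzy AG-subgroup of $G$ (written $\mu\in F(G)$) if for all $x,y\in G$: $\mu(xy)\ge\mu(x)\wedge\mu(y)$ and $\mu(x^{-1})\ge\mu(x)$. It is a normal fuzzy AG-subgroup (written $\mu\in NF(G)$) if moreover $\mu(xy\cdot x^{-1})=\mu(y)$ for all $x,y\in G$. For $\mu\in F(G)$ and $x\in G$, the fuzzy coset $\mu_x:G\to[0,1]$ is defined by $\mu_x(g)=\mu(gx^{-1})$ for all $g\in G$. *)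

(* Defs.v *)
From mathcomp Require Import all_boot all_order all_algebra.
From mathcomp Require Import all_classical all_reals.
From mathcomp Require Import interval_inference.
Set Implicit Arguments.
Unset Strict Implicit.
Unset Printing Implicit Defensive.
Import Order.TTheory GRing.Theory Num.Theory.

Local Open Scope classical_set_scope.
Local Open Scope ring_scope.

Definition left_invertive (G : Type) (op : G -> G -> G) : Prop :=
  forall a b c : G, op (op a b) c = op (op c b) a.

(* The inverse is a component of the structure for convenience only: the left
   invertive law and the left identity determine the inverse of each element. *)
Record ag_group (G : Type) : Type := AGGroup {
  ag_mul : G -> G -> G;
  ag_one : G;
  ag_inv : G -> G;
  ag_mul_left_invertive : left_invertive ag_mul;
  ag_mul1g : left_id ag_one ag_mul;
  ag_one_unique : forall e : G, left_id e ag_mul -> e = ag_one;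
  ag_mulVg : left_inverse ag_one ag_inv ag_mul;
  ag_mulgV : right_inverse ag_one ag_inv ag_mul
}.

(* [{i01 R}] is the subtype of the x : R such that 0 <= x <= 1, with the
   order inherited from R. *)
Definition fuzzy_subset (R : realType) (G : Type) : Type := G -> {i01 R}.

Definition fuzzy_ag_subgroup (R : realType) (G : Type) (A : ag_group G) :
    set (fuzzy_subset R G) :=
  [set mu | (forall x y : G, mu (ag_mul A x y) >= Order.min (mu x) (mu y))
         /\ (forall x : G, mu (ag_inv A x) >= mu x)].

Definition normal_fuzzy_ag_subgroup (R : realType) (G : Type)
    (A : ag_group G) : set (fuzzy_subset R G) :=
  [set mu | fuzzy_ag_subgroup A mu
         /\ (forall x y : G,
               mu (ag_mul A (ag_mul A x y) (ag_inv A x)) = mu y)].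

Definition fuzzy_coset (R : realType) (G : Type) (A : ag_group G)
    (mu : fuzzy_subset R G) (x : G) : fuzzy_subset R G :=
  fun g : G => mu (ag_mul A g (ag_inv A x)).

(* The set of fuzzy cosets, as a type: its elements are functions on G, so
   that the classes of x and y are equal iff their fuzzy cosets are the same
   function. *)
Definition fuzzy_quotient (R : realType) (G : Type) (A : ag_group G)
    (mu : fuzzy_subset R G) : Type :=
  set_type (range (fuzzy_coset A mu)).

Definition coset_class (R : realType) (G : Type) (A : ag_group G)
    (mu : fuzzy_subset R G) (x : G) : fuzzy_quotient A mu :=
  SigSub (mem_set (imageT (fuzzy_coset A mu) x)).

(* Main.v *)
Require Import Defs.
From mathcomp Require Import all_boot all_order all_algebra.
From mathcomp Require Import all_classical all_reals.
From mathcomp Require Import interval_inference.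

(** Normality at [x = e] reads [mu (y e) = mu y]; as [(a b) e = b a], this makes
    [mu] symmetric: [mu (a b) = mu (b a)].  Since [(x y)^-1 = x^-1 y^-1], the
    coset of [x y] can then be written as a translate of the coset of [x], and
    also as a translate of the coset of [y], so it depends only on these two
    functions.  The AG-group laws pass to the quotient through representatives. *)

Section AGGroupTheory.
Unset Strict Implicit.
Set Implicit Arguments.
Variables (G : Type) (A : ag_group G).
Local Notation "x * y" := (ag_mul A x y).
Local Notation "1" := (ag_one A).
Local Notation "x ^-1" := (ag_inv A x).

Lemma ag_mulAC (a b c : G) : a * b * c = c * b * a.
Proof. exact: ag_mul_left_invertive. Qed.

(** Regrouping as [((c d) b) a] brings [b] and [c] together, where one more exchange swaps them. *)
Lemma ag_medial (a b c d : G) : (a * b) * (c * d) = (a * c) * (b * d).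
Proof. by rewrite ag_mulAC (ag_mulAC c d b) ag_mulAC. Qed.

(** Writing [a] as [1 a] supplies the fourth factor for the medial law. *)
Lemma ag_mulCA (a b c : G) : a * (b * c) = b * (a * c).
Proof. by rewrite -{1}(ag_mul1g A a) ag_medial ag_mul1g. Qed.

Lemma ag_paramedial (a b c d : G) : (a * b) * (c * d) = (d * c) * (b * a).
Proof. by rewrite ag_mulCA (ag_mulAC a b d) ag_mulCA ag_medial. Qed.

Lemma ag_mulg1 (a b : G) : a * b * 1 = b * a.
Proof. by rewrite ag_mulAC ag_mul1g. Qed.

Lemma ag_inv1 : 1^-1 = 1.
Proof. by rewrite -[LHS](ag_mul1g A) ag_mulgV. Qed.

(** Without associativity, the left invertive law does the work:
    [a^-1 = (b a) a^-1 = (a^-1 a) b = b]. *)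
Lemma ag_inv_uniq (a b : G) : b * a = 1 -> b = a^-1.
Proof.
by move=> ba1; rewrite -[RHS](ag_mul1g A) -ba1 ag_mulAC ag_mulVg ag_mul1g.
Qed.

(** The order of the factors is kept because the medial law pairs [a^-1] with [a] and [b^-1] with
    [b]. *)
Lemma ag_invM (a b : G) : (a * b)^-1 = a^-1 * b^-1.
Proof. by apply/esym/ag_inv_uniq; rewrite ag_medial !ag_mulVg ag_mul1g. Qed.

End AGGroupTheory.

(** The chain is [e' = (e e) e' = (e' e) e = e]. *)
Lemma left_invertive_id_uniq (T : Type) (op : T -> T -> T) (e e' : T) :
  left_invertive op -> left_id e op -> left_id e' op -> e' = e.
Proof. by move=> opinv e1 e'1; rewrite -[LHS]e1 -{1}(e1 e) opinv e'1 e1. Qed.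

Section FuzzyQuotient.
Set Implicit Arguments.
Unset Strict Implicit.
Variables (R : realType) (G : Type) (A : ag_group G) (mu : fuzzy_subset R G).
Local Notation "x * y" := (ag_mul A x y).
Local Notation "1" := (ag_one A).
Local Notation "x ^-1" := (ag_inv A x).

Lemma coset_class_eq (x y : G) :
  coset_class A mu x = coset_class A mu y <->
  fuzzy_coset A mu x = fuzzy_coset A mu y.
Proof. by split=> [/(congr1 val)//|eq_xy]; apply: val_inj. Qed.

Lemma coset_class_surj (c : fuzzy_quotient A mu) :
  exists x, coset_class A mu x = c.
Proof. by have /set_mem[x _ xc] := valP c; exists x; apply: val_inj. Qed.

Definition coset_repr (c : fuzzy_quotient A mu) : G :=
  projT1 (cid (coset_class_surj c)).

Lemma coset_reprK : cancel coset_repr (coset_class A mu).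
Proof. by move=> c; rewrite /coset_repr; case: cid. Qed.

(** Chosen representatives make this a total function on classes; [coset_mulE] shows that the choice
    does not matter. *)
Definition coset_mul (c d : fuzzy_quotient A mu) : fuzzy_quotient A mu :=
  coset_class A mu (coset_repr c * coset_repr d).

Definition coset_inv (c : fuzzy_quotient A mu) : fuzzy_quotient A mu :=
  coset_class A mu (coset_repr c)^-1.

Hypothesis hmu : normal_fuzzy_ag_subgroup A mu.

Lemma normal_fuzzyC (a b : G) : mu (a * b) = mu (b * a).
Proof.
have [_ /(_ 1 (b * a))] := hmu.
by rewrite ag_inv1 ag_mul1g ag_mulg1.
Qed.

Lemma fuzzy_cosetMl (x y g : G) :
  fuzzy_coset A mu (x * y) g = fuzzy_coset A mu x (g * y^-1).
Proof. by rewrite /fuzzy_coset ag_invM ag_mulCA normal_fuzzyC. Qed.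

(** As [1] is only a left identity, [g * 1] need not be [g]; the paramedial law turns it into
    [1 * g], which is [g]. *)
Lemma fuzzy_cosetMr (x y g : G) :
  fuzzy_coset A mu (x * y) g = fuzzy_coset A mu y (g * 1 * x^-1).
Proof.
by rewrite /fuzzy_coset ag_invM [in RHS]ag_mulAC ag_paramedial ag_mul1g.
Qed.

Lemma coset_mulE (x y : G) :
  coset_mul (coset_class A mu x) (coset_class A mu y) =
  coset_class A mu (x * y).
Proof.
rewrite /coset_mul.
have /coset_class_eq xE := coset_reprK (coset_class A mu x).
have /coset_class_eq yE := coset_reprK (coset_class A mu y).
apply/coset_class_eq/funext => g.
(* The representatives are replaced one at a time: first that of [x], with the right factor fixed,
   then that of [y]. *)
by rewrite fuzzy_cosetMl xE -fuzzy_cosetMl fuzzy_cosetMr yE -fuzzy_cosetMr.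
Qed.

Lemma coset_mul_left_invertive : left_invertive coset_mul.
Proof.
move=> a b c; rewrite -(coset_reprK a) -(coset_reprK b) -(coset_reprK c).
by rewrite !coset_mulE ag_mulAC.
Qed.

Lemma coset_mul1g : left_id (coset_class A mu 1) coset_mul.
Proof. by move=> c; rewrite -(coset_reprK c) coset_mulE ag_mul1g. Qed.

Lemma coset_one_unique (e : fuzzy_quotient A mu) :
  left_id e coset_mul -> e = coset_class A mu 1.
Proof.
exact: left_invertive_id_uniq coset_mul_left_invertive coset_mul1g.
Qed.

Lemma coset_mulVg : left_inverse (coset_class A mu 1) coset_inv coset_mul.
(* The occurrence of [c] inside [coset_inv] stays: that term already unfolds to the class of an
   inverse of the same representative. *)
Proof. by move=> c; rewrite -{2}(coset_reprK c) coset_mulE ag_mulVg. Qed.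

Lemma coset_mulgV : right_inverse (coset_class A mu 1) coset_inv coset_mul.
Proof. by move=> c; rewrite -{1}(coset_reprK c) coset_mulE ag_mulgV. Qed.

Definition quotient_ag_group : ag_group (fuzzy_quotient A mu) :=
  AGGroup coset_mul_left_invertive coset_mul1g coset_one_unique
    coset_mulVg coset_mulgV.

End FuzzyQuotient.

Theorem theorem2 (R : realType) (G : Type) (A : ag_group G)
    (mu : fuzzy_subset R G) (hmu : normal_fuzzy_ag_subgroup A mu) :
  exists Q : ag_group (fuzzy_quotient A mu),
    unique
      (fun op : fuzzy_quotient A mu -> fuzzy_quotient A mu ->
                fuzzy_quotient A mu =>
         forall x y : G,
           op (coset_class A mu x) (coset_class A mu y)
           = coset_class A mu (ag_mul A x y))
      (ag_mul Q).
Proof.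
exists (quotient_ag_group hmu); split => [x y|op opE]; first exact: coset_mulE.
(* Uniqueness: every class has a representative, so the values of [op] on classes of elements are
   all its values. *)
apply/funext => c; apply/funext => d.
by rewrite -(coset_reprK c) -(coset_reprK d) opE /= coset_mulE.
Qed.
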